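(* Let $X=\ell_p\otimes_\pi\ell_q\otimes_\pi\ell_r$ with $1\le p\le q\le r\le\infty$. Then $C_\alpha(X)=\infty$ in the following cases: (a) $p\le 2$, $\frac1q+\frac1r<\frac12$, $\frac1p+\frac1q+\frac1r\ge 1$, and $\alpha<\dfrac{3}{1+\frac1q+\frac1r}$; (b) $p<2$, $\frac1p+\frac1q+\frac1r\le 1$, and $\alpha<\dfrac{3}{2-\frac1p}$; (c) $\frac1p+\frac1q+\frac1r<\frac12$, and $\alpha<\dfrac{3}{1+\frac1p+\frac1q+\frac1r}$.
   Context: All spaces are real and $1/\infty=0$. $\ell_p$ is the usual infinite-dimensional sequence space. $X=\ell_p\otimes_\pi\ell_q\otimes_\pi\ell_r$ is the (completed) algebraic tensor product with the projective norm $\|A\|=\inf\{\sum_{l=1}^m\|x_l\|_p\|y_l\|_q\|z_l\|_r: m\in\mathbb{N},\ A=\sum_{l=1}^m x_l\otimes y_l\otimes z_l\}$. For a Banach space $X$ and an exponent $\alpha>0$, $C_\alpha(X)$ (the Rademacher cotype $\alpha$ constant) is the smallest $C\in(0,\infty)$ such that for all $m\in\mathbb{N}$ and $x_1,\dots,x_m\in X$, $\left(\sum_{i=1}^m\|x_i\|_X^\alpha\right)^{1/\alpha}\le C\,\mathbb{E}\left\|\sum_{i=1}^m\varepsilon_ix_i\right\|_X$, where $\varepsilon_i$ are independent with $\mathbb{P}(\varepsilon_i=1)=\mathbb{P}(\varepsilon_i=-1)=\frac12$; $C_\alpha(X)=\infty$ if no such $C$ exists. *)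

(* Defs.v *)
From HB Require Import structures.
From mathcomp Require Import all_boot all_order all_algebra.
From mathcomp Require Import lra.
From mathcomp Require Import all_classical all_reals all_analysis.

Set Implicit Arguments.
Unset Strict Implicit.
Unset Printing Implicit Defensive.

Import Order.TTheory GRing.Theory Num.Theory.
Import numFieldNormedType.Exports.

Local Open Scope classical_set_scope.
Local Open Scope ring_scope.

(* With respect to the counting measure on [nat] every sequence is measurable
   and every nonempty set has positive measure, so that [Lnorm] is the usual
   l_p norm (the sup norm if p = +oo) and no quotient by a.e. equality is
   needed to make it definite. *)
Definition ellp (R : realType) (p : \bar R) (hp : (1 <= p)%E) : Type :=
  LfunType (counting : {measure set nat -> \bar R}) hp.

Section EllpNorm.
Context (R : realType) (p : \bar R) (hp : (1 <= p)%E).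

HB.instance Definition _ := GRing.Lmodule.on (ellp hp).

Definition ellp_norm (u : ellp hp) : R :=
  fine ('N[(counting : {measure set nat -> \bar R})]_p [EFin \o u])%E.

Lemma ler_ellp_normD (u v : ellp hp) :
  ellp_norm (u + v) <= ellp_norm u + ellp_norm v.
Proof. exact: ler_LnormD. Qed.

Lemma ellp_normZ (a : R) (u : ellp hp) :
  ellp_norm (a *: u) = `|a| * ellp_norm u.
Proof.
apply: EFin_inj; rewrite EFinM !finite_norm_fine.
exact: LnormZ.
Qed.

Lemma ellp_norm0_eq0 (u : ellp hp) : ellp_norm u = 0 -> u = 0.
Proof.
move=> /fine_Lnormr_eq0[A [mA A0 uA]].
apply/LfuneqP => n; apply: contrapT => un0.
have /uA An : (~` [set x | [set: nat] x -> u x = (0 : ellp hp) x]) n by move=> /(_ I).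
have : (counting [set n] <= @counting _ R A)%E.
  by apply: le_measure; rewrite ?inE// => _ ->.
by rewrite A0 /counting asboolT// fset_set1 lee_fin finmap.cardfs1 ler10.
Qed.

HB.instance Definition _ := Lmodule_isNormed.Build R (ellp hp)
  ler_ellp_normD ellp_normZ ellp_norm0_eq0.

End EllpNorm.

Section Tensor.
Context (R : realType) (E F G : lmodType R).

Definition trilinear (b : E -> F -> G -> R) : Prop :=
  [/\ forall y z, scalar (fun x => b x y z),
      forall x z, scalar (fun y => b x y z) &
      forall x y, scalar (fun z => b x y z)].

Definition triform := {b : E -> F -> G -> R | trilinear b}.

(* The algebraic tensor product is the span, inside the functions on trilinear
   forms, of the evaluations b |-> b x y z: over a field trilinear forms
   separate the points of E (x) F (x) G, so two formal sums of elementary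
   tensors have the same image here iff they are equal in E (x) F (x) G. *)
Definition elem_tensor (x : E) (y : F) (z : G) : triform -> R :=
  fun b => sval b x y z.

Definition sum_tensor (s : seq (E * F * G)) : triform -> R :=
  \sum_(t <- s) elem_tensor t.1.1 t.1.2 t.2.

Definition is_tensor : {pred triform -> R} :=
  [pred A | `[< exists s, A = sum_tensor s >]].

Lemma elem_tensorZ (a : R) (x : E) (y : F) (z : G) :
  elem_tensor (a *: x) y z = a *: elem_tensor x y z.
Proof.
apply: funext => -[b [b1 b2 b3]]; rewrite /elem_tensor/=.
have b0 : b 0 y z = 0.
  have := b1 y z 1 0 0; rewrite scale1r addr0 /= mul1r => /eqP.
  by rewrite -subr_eq subrr eq_sym => /eqP.
by have := b1 y z a x 0; rewrite addr0 b0 addr0.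
Qed.

Lemma sum_tensor_cat (s t : seq (E * F * G)) :
  sum_tensor (s ++ t) = sum_tensor s + sum_tensor t.
Proof. by rewrite /sum_tensor big_cat. Qed.

Definition scale_reps (a : R) (s : seq (E * F * G)) : seq (E * F * G) :=
  [seq (a *: t.1.1, t.1.2, t.2) | t <- s].

Lemma sum_tensorZ (a : R) (s : seq (E * F * G)) :
  sum_tensor (scale_reps a s) = a *: sum_tensor s.
Proof.
rewrite /sum_tensor big_map scaler_sumr; apply: eq_bigr => t _.
exact: elem_tensorZ.
Qed.

Lemma is_tensor_submod_closed : submod_closed is_tensor.
Proof.
split=> [|a A B]; rewrite !inE.
  by exists [::]; rewrite /sum_tensor big_nil.
move=> [s ->] [t ->].
by exists (scale_reps a s ++ t); rewrite sum_tensor_cat sum_tensorZ.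
Qed.

HB.instance Definition _ := GRing.isSubmodClosed.Build _ _ is_tensor
  is_tensor_submod_closed.

Record tensor := Tensor {
  tensor_val :> triform -> R;
  tensor_valP : tensor_val \in is_tensor }.

HB.instance Definition _ := [isSub for tensor_val].
HB.instance Definition _ := [Choice of tensor by <:].
HB.instance Definition _ := [SubChoice_isSubLmodule of tensor by <:].

End Tensor.

Section ProjectiveNorm.
Context (R : realType) (E F G : normedModType R).

Definition rep_cost (s : seq (E * F * G)) : R :=
  \sum_(t <- s) `|t.1.1| * `|t.1.2| * `|t.2|.

Definition proj_norm (A : tensor E F G) : R :=
  inf [set rep_cost s | s in [set s | val A = sum_tensor s]].

Let costs (A : tensor E F G) := [set rep_cost s | s in [set s | val A = sum_tensor s]].

Lemma rep_cost_ge0 (s : seq (E * F * G)) : 0 <= rep_cost s.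
Proof. by apply: sumr_ge0 => t _; rewrite !mulr_ge0. Qed.

Lemma proj_norm_costs (A : tensor E F G) : has_inf (costs A).
Proof.
split; last by exists 0 => _ [s _ <-]; exact: rep_cost_ge0.
have := tensor_valP A; rewrite inE => -[s As].
by exists (rep_cost s), s.
Qed.

Lemma proj_norm_le (A : tensor E F G) s :
  val A = sum_tensor s -> proj_norm A <= rep_cost s.
Proof.
move=> As; apply: ge_inf; first by have [] := proj_norm_costs A.
by exists s.
Qed.

Lemma proj_normD (A B : tensor E F G) :
  proj_norm (A + B) <= proj_norm A + proj_norm B.
Proof.
apply/ler_addgt0Pr => e e0.
have e2 : 0 < e / 2 by rewrite divr_gt0.
have [_ [s As <-] sA] := inf_adherent e2 (proj_norm_costs A).
have [_ [t Bt <-] tB] := inf_adherent e2 (proj_norm_costs B).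
have /proj_norm_le/le_trans -> // : val (A + B) = sum_tensor (s ++ t).
  by rewrite sum_tensor_cat -As -Bt.
rewrite /rep_cost big_cat/= [e]splitr addrACA.
by apply: lerD; exact: ltW.
Qed.

Let proj_normZ_le (a : R) (A : tensor E F G) :
  proj_norm (a *: A) <= `|a| * proj_norm A.
Proof.
have H s : val A = sum_tensor s -> proj_norm (a *: A) <= `|a| * rep_cost s.
  move=> As; have /proj_norm_le/le_trans -> // :
    val (a *: A) = sum_tensor (scale_reps a s) by rewrite sum_tensorZ -As.
  rewrite /rep_cost big_map mulr_sumr; apply: ler_sum => t _ /=.
  by rewrite normrZ !mulrA.
have [a0|a0] := eqVneq a 0.
  have [[_ [s As _]] _] := proj_norm_costs A.
  have := H _ As; rewrite a0 normr0 2!mul0r; exact.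
rewrite mulrC -ler_pdivrMr ?normr_gt0//.
apply: lb_le_inf; first by have [] := proj_norm_costs A.
move=> _ [s As <-]; rewrite ler_pdivrMr ?normr_gt0// mulrC.
exact: H.
Qed.

Lemma proj_normZ (a : R) (A : tensor E F G) :
  proj_norm (a *: A) = `|a| * proj_norm A.
Proof.
apply/eqP; rewrite eq_le proj_normZ_le/=.
have [->|a0] := eqVneq a 0.
  rewrite normr0 mul0r; apply: lb_le_inf; first by have [] := proj_norm_costs (0 *: A).
  by move=> _ [s _ <-]; exact: rep_cost_ge0.
rewrite mulrC -ler_pdivlMr ?normr_gt0// mulrC -normfV.
by rewrite -[A in X in X <= _](scalerK a0) proj_normZ_le.
Qed.

End ProjectiveNorm.

Record seminorm (R : realType) (V : lmodType R) := Seminorm {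
  seminorm_fun :> V -> R;
  seminormD : forall u v, seminorm_fun (u + v) <= seminorm_fun u + seminorm_fun v;
  seminormZ : forall a v, seminorm_fun (a *: v) = `|a| * seminorm_fun v }.

Section Completion.
Context (R : realType) (V : lmodType R) (N : seminorm V).

Lemma seminorm0 : N 0 = 0.
Proof. by rewrite -(scale0r 0) seminormZ normr0 mul0r. Qed.

Lemma seminormN v : N (- v) = N v.
Proof. by rewrite -scaleN1r seminormZ normrN1 mul1r. Qed.

Lemma seminormB v w : N (v - w) = N (w - v).
Proof. by rewrite -seminormN opprB. Qed.

Lemma seminorm_ge0 v : 0 <= N v.
Proof.
have := seminormD N v (- v); rewrite subrr seminorm0 seminormN -mulr2n.
by rewrite pmulrn_lge0.
Qed.

Lemma seminorm_dist v w : `|N v - N w| <= N (v - w).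
Proof.
have H a b : N a <= N (a - b) + N b by rewrite -{1}(subrK b a) seminormD.
by rewrite ler_norml lerBlDr H andbT lerNl opprB lerBlDr seminormB H.
Qed.

Definition is_cauchy : {pred nat -> V} :=
  [pred u | `[< forall e : R, 0 < e -> exists n0, forall m n,
     (n0 <= m)%N -> (n0 <= n)%N -> N (u m - u n) < e >]].

Lemma is_cauchy_submod_closed : submod_closed is_cauchy.
Proof.
split=> [|a u v]; rewrite !inE.
  move=> e e0; exists 0%N => m n _ _ /=.
  by rewrite subrr seminorm0.
move=> cu cv e e0.
have a0 : 0 < `|a| + 1 by rewrite ltr_wpDl.
have e2 : 0 < e / 2 by rewrite divr_gt0.
have [n1 H1] := cu _ (divr_gt0 e2 a0).
have [n2 H2] := cv _ e2.
exists (maxn n1 n2) => m n; rewrite !geq_max => /andP[m1 m2] /andP[k1 k2].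
rewrite [X in N X](_ : _ = a *: (u m - u n) + (v m - v n)); last first.
  by rewrite scalerBr addrACA opprD.
rewrite (le_lt_trans (seminormD _ _ _))// [e]splitr ler_ltD ?H2// seminormZ.
have := ltW (H1 _ _ m1 k1); rewrite ler_pdivlMr// => /(le_trans _); apply.
by rewrite mulrC ler_wpM2l ?seminorm_ge0// lerDl.
Qed.

HB.instance Definition _ := GRing.isSubmodClosed.Build _ _ is_cauchy
  is_cauchy_submod_closed.

Record cauchy_sequence := CauchySequence {
  cauchy_val :> nat -> V;
  cauchy_valP : cauchy_val \in is_cauchy }.

HB.instance Definition _ := [isSub for cauchy_val].
HB.instance Definition _ := [Choice of cauchy_sequence by <:].
HB.instance Definition _ := [SubChoice_isSubLmodule of cauchy_sequence by <:].

Implicit Types u v : cauchy_sequence.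

Lemma cauchy_sequenceP u (e : R) : 0 < e -> exists n0, forall m n,
  (n0 <= m)%N -> (n0 <= n)%N -> N (u m - u n) < e.
Proof. by have := cauchy_valP u; rewrite inE => /(_ e). Qed.

Definition cauchy_norm u : R := limn (fun n => N (u n)).

Lemma cvg_cauchy_norm u : (fun n => N (u n)) @ \oo --> cauchy_norm u.
Proof.
apply: cauchy_cvg; apply: cauchy_exP => e e0.
have [n0 H] := cauchy_sequenceP u e0; exists (N (u n0)).
exists n0 => // n /= n0n; rewrite /ball/=.
by rewrite (le_lt_trans (seminorm_dist _ _))// H.
Qed.

Lemma cauchy_norm_le u (c : R) :
  (\forall n \near \oo, N (u n) <= c) -> cauchy_norm u <= c.
Proof. by move=> uc; apply: limr_le uc; exact: cvg_cauchy_norm. Qed.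

Lemma cauchy_norm_ge0 u : 0 <= cauchy_norm u.
Proof.
apply: limr_ge; first exact: cvg_cauchy_norm.
by apply: nearW => n; exact: seminorm_ge0.
Qed.

Lemma cauchy_normD u v : cauchy_norm (u + v) <= cauchy_norm u + cauchy_norm v.
Proof.
have uv : (fun n => N (u n) + N (v n)) @ \oo --> cauchy_norm u + cauchy_norm v.
  by apply: cvgD; exact: cvg_cauchy_norm.
apply: (ler_cvg_to (@cvg_cauchy_norm (u + v)) uv).
by apply: nearW => n; exact: seminormD.
Qed.

Lemma cauchy_normZ (a : R) u : cauchy_norm (a *: u) = `|a| * cauchy_norm u.
Proof.
apply/cvg_lim => //; under eq_fun do rewrite seminormZ.
by apply: cvgMr; exact: cvg_cauchy_norm.
Qed.

Definition is_null : {pred cauchy_sequence} := [pred u | cauchy_norm u == 0].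

Lemma is_null_submod_closed : submod_closed is_null.
Proof.
split=> [|a u v]; rewrite !inE.
  by rewrite -(scale0r 0) cauchy_normZ normr0 mul0r.
move=> /eqP u0 /eqP v0; rewrite eq_le cauchy_norm_ge0 andbT.
by rewrite (le_trans (cauchy_normD _ _))// cauchy_normZ u0 v0 mulr0 addr0.
Qed.

HB.instance Definition _ := GRing.isSubmodClosed.Build _ _ is_null
  is_null_submod_closed.

(* Cauchy sequences modulo null sequences; [N] need only be a seminorm. It will
   be the projective norm, which is definite (Hahn-Banach), so that distinct
   algebraic tensors stay distinct in the completion. *)
Definition completion : Type := {ideal_quot is_null}.

HB.instance Definition _ := GRing.Zmodule.on completion.

Local Notation pi := (\pi_({ideal_quot is_null})%qT : cauchy_sequence -> completion).

Lemma completion_eq u v : pi u = pi v <-> cauchy_norm (u - v) = 0.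
Proof.
split=> [/eqP uv|/eqP uv]; last by apply/eqP; rewrite -Quotient.idealrBE inE.
by apply/eqP; move: uv; rewrite -Quotient.idealrBE inE.
Qed.

Lemma completion_reprE (x : completion) : pi (repr x) = x.
Proof. exact: reprK. Qed.

Lemma completion_repr u : cauchy_norm (repr (pi u) - u) = 0.
Proof. by apply/completion_eq; rewrite completion_reprE. Qed.

Lemma completion_piD u v : pi (u + v) = pi u + pi v.
Proof. exact: raddfD. Qed.

Definition completion_scale (a : R) (x : completion) : completion :=
  pi (a *: repr x).

Lemma completion_scaleE (a : R) u : completion_scale a (pi u) = pi (a *: u).
Proof.
apply/completion_eq; rewrite -scalerBr cauchy_normZ.
by rewrite completion_repr mulr0.
Qed.

Lemma completion_scalerA (a b : R) (x : completion) :
  completion_scale a (completion_scale b x) = completion_scale (a * b) x.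
Proof. by rewrite -[x]completion_reprE !completion_scaleE scalerA. Qed.

Lemma completion_scale1r : left_id 1 completion_scale.
Proof. by move=> x; rewrite -[x]completion_reprE completion_scaleE scale1r. Qed.

Lemma completion_scalerDr : right_distributive completion_scale +%R.
Proof.
move=> a x y; rewrite -[x]completion_reprE -[y]completion_reprE.
by rewrite -completion_piD !completion_scaleE scalerDr completion_piD.
Qed.

Lemma completion_scalerDl (x : completion) :
  {morph completion_scale^~ x : a b / a + b}.
Proof.
move=> a b; rewrite -[x]completion_reprE.
by rewrite !completion_scaleE scalerDl completion_piD.
Qed.

HB.instance Definition _ := GRing.Zmodule_isLmodule.Build R completion
  completion_scalerA completion_scale1r completion_scalerDr completion_scalerDl.

Lemma completion_piZ (a : R) u : pi (a *: u) = a *: pi u.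
Proof. by rewrite -completion_scaleE. Qed.

Definition completion_norm (x : completion) : R := cauchy_norm (repr x).

Lemma completion_normE u : completion_norm (pi u) = cauchy_norm u.
Proof.
rewrite /completion_norm; apply/eqP; rewrite eq_le.
have u0 := completion_repr u.
have v0 : cauchy_norm (u - repr (pi u)) = 0.
  by rewrite -opprB -scaleN1r cauchy_normZ u0 mulr0.
apply/andP; split.
  rewrite -[X in cauchy_norm X <= _](subrK u) (le_trans (cauchy_normD _ _))//.
  by rewrite u0 add0r.
rewrite -[X in cauchy_norm X <= _](subrK (repr (pi u))).
by rewrite (le_trans (cauchy_normD _ _))// v0 add0r.
Qed.

Lemma completion_normD (x y : completion) :
  completion_norm (x + y) <= completion_norm x + completion_norm y.
Proof.
rewrite -[x]completion_reprE -[y]completion_reprE -completion_piD.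
by rewrite !completion_normE cauchy_normD.
Qed.

Lemma completion_normZ (a : R) (x : completion) :
  completion_norm (a *: x) = `|a| * completion_norm x.
Proof.
by rewrite -[x]completion_reprE -completion_piZ !completion_normE cauchy_normZ.
Qed.

Lemma completion_norm0_eq0 (x : completion) : completion_norm x = 0 -> x = 0.
Proof.
rewrite -[x]completion_reprE completion_normE => x0.
have -> : (0 : completion) = pi 0 by rewrite raddf0.
by apply/completion_eq; rewrite subr0.
Qed.

HB.instance Definition _ := Lmodule_isNormed.Build R completion
  completion_normD completion_normZ completion_norm0_eq0.

Lemma cst_is_cauchy (v : V) : (fun=> v) \in is_cauchy.
Proof.
by rewrite inE => e e0; exists 0%N => m n _ _; rewrite subrr seminorm0.
Qed.

Definition completion_embed (v : V) : completion :=
  pi (CauchySequence (cst_is_cauchy v)).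

Lemma completion_embed_is_linear : linear completion_embed.
Proof.
move=> a v w; rewrite /completion_embed -completion_piZ -completion_piD.
by congr (pi _); apply: val_inj.
Qed.

HB.instance Definition _ := GRing.isLinear.Build R V completion _
  completion_embed completion_embed_is_linear.

Lemma norm_completion_embed (v : V) : `|completion_embed v| = N v.
Proof.
rewrite [LHS]completion_normE.
rewrite -[RHS](@lim_cst R _ nat \oo)//; exact: Rhausdorff.
Qed.

Lemma norm_sub_completion_embed u (v : V) :
  `|pi u - completion_embed v| = limn (fun n => N (u n - v)).
Proof.
pose c := CauchySequence (cst_is_cauchy v).
have -> : pi u - completion_embed v = pi (u - c) by rewrite [RHS]raddfB.
exact: completion_normE.
Qed.

Lemma completion_embed_dense (x : completion) (e : R) :
  0 < e -> exists v : V, `|x - completion_embed v| < e.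
Proof.
move=> e0; rewrite -[x]completion_reprE; set u := repr x.
have e2 : 0 < e / 2 by rewrite divr_gt0.
have [n0 H] := cauchy_sequenceP u e2; exists (u n0).
rewrite norm_sub_completion_embed (@le_lt_trans _ _ (e / 2))//; last first.
  by rewrite ltr_pdivrMr// ltr_pMr// ltr1n.
pose c := CauchySequence (cst_is_cauchy (u n0)).
apply: (@cauchy_norm_le (u - c)).
by exists n0 => // n /= n0n; rewrite ltW// H.
Qed.

Lemma completion_complete (F : set_system completion) :
  ProperFilter F -> cauchy F -> cvg F.
Proof.
move=> PF /cauchyP Fc.
have Fv (k : nat) : exists w : V, F (ball (completion_embed w) (k.+1%:R^-1 : R)).
  have k2 : 0 < (k.+1%:R^-1 / 2 : R) by rewrite divr_gt0.
  have [x Fx] := Fc _ k2.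
  have [w xw] := completion_embed_dense x k2; exists w.
  apply: filterS Fx => y xy; apply: ball_splitr xy.
  by rewrite -ball_normE.
have [v vP] := choice Fv.
have Nv m n : N (v m - v n) < m.+1%:R^-1 + n.+1%:R^-1.
  have [y [/= vm vn]] := filter_ex (filterI (vP m) (vP n)).
  rewrite -norm_completion_embed raddfB/=.
  have := ball_triangle vm (ball_sym vn).
  by rewrite -ball_normE.
have inv_lt (e : R) : 0 < e -> exists k, k.+1%:R^-1 < e.
  move=> e0; have [k _ H] := near_infty_natSinv_lt (PosNum e0).
  by exists k; exact: (H k (leqnn k)).
have inv_le (k n : nat) : (k <= n)%N -> (n.+1%:R^-1 : R) <= k.+1%:R^-1.
  by move=> kn; rewrite lef_pV2 ?posrE// ler_nat.
have vc : v \in is_cauchy.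
  rewrite inE => e e0.
  have [k ke] := inv_lt _ (divr_gt0 e0 (ltr0Sn R 1)).
  exists k => m n km kn; rewrite (lt_trans (Nv m n))// [e]splitr.
  by rewrite ltrD// (le_lt_trans _ ke)// inv_le.
pose u := CauchySequence vc; apply/cvg_ex; exists (pi u).
apply/cvgrPdist_lt => e e0.
have [k ke] := inv_lt _ (divr_gt0 e0 (ltr0Sn R 2)).
apply: filterS (vP k) => y; rewrite -ball_normE/= => vy.
rewrite -(subrKA (completion_embed (v k))) (le_lt_trans (ler_normD _ _))//.
have uk : `|pi u - completion_embed (v k)| <= k.+1%:R^-1 + k.+1%:R^-1.
  rewrite norm_sub_completion_embed.
  apply: (@cauchy_norm_le (u - CauchySequence (cst_is_cauchy (v k)))).
  exists k => // n /= kn; rewrite (le_trans (ltW (Nv n k)))//.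
  by rewrite lerD2r inv_le.
move: uk vy ke; set t := k.+1%:R^-1; set a := `|_|; set b := `|_|.
by lra.
Qed.

HB.instance Definition _ := Uniform_isComplete.Build completion
  completion_complete.

End Completion.

Section ProjectiveTensorProduct.
Context (R : realType) (E F G : normedModType R).

Definition proj_seminorm : seminorm (tensor E F G) :=
  Seminorm (@proj_normD R E F G) (@proj_normZ R E F G).

Definition proj_tensor : completeNormedModType R := completion proj_seminorm.

End ProjectiveTensorProduct.

Section Cotype.
Context (R : realType) (X : normedModType R).

(* The expectation of the norm of a Rademacher sum: independent uniform signs
   are a uniformly distributed point of {1, -1}^m. *)
Definition rademacher_mean (m : nat) (x : 'I_m -> X) : R :=
  (2 ^+ m)^-1 *
    \sum_(eps : {ffun 'I_m -> bool}) `|\sum_(i < m) (-1) ^+ eps i *: x i|.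

Definition cotype_bound (alpha C : R) : Prop :=
  forall (m : nat) (x : 'I_m -> X),
    (\sum_(i < m) `|x i| `^ alpha) `^ alpha^-1 <= C * rademacher_mean x.

Definition cotype_const (alpha : R) : \bar R :=
  ereal_inf [set C%:E | C in [set C | 0 < C /\ cotype_bound alpha C]].

End Cotype.

(* Main.v *)
From HB Require Import structures.
Require Import Defs.
From mathcomp Require Import all_boot all_order all_algebra.
From mathcomp Require Import lra.
From mathcomp Require Import all_classical all_reals all_analysis.
From mathcomp Require Import ess_sup_inf.

(** In each of the three cases the hypotheses give alpha < 3, since the
    denominator in the bound on alpha is at least 1, and 1/q + 1/r < 1/2: this
    is assumed in (a), follows from 1/q + 1/r <= 1 - 1/p < 1/2 in (b), and is
    weaker than the assumption in (c). As q <= r, the second inequality forces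
    r > 4, so alpha < r.

    The failure of cotype then comes from the last factor alone. Let e_k denote
    the k-th unit vector. The tensors e_0 (x) e_0 (x) e_i for i < m have norm
    at least 1, because the trilinear form (x, y, z) |-> x_0 y_0 z_i has norm
    at most 1 and takes the value 1 there
    ([trilinear_le_norm_pure_tensor]). On the other hand every signed sum of
    them is the elementary tensor e_0 (x) e_0 (x) (sum_i +-e_i), whose norm is
    at most m^(1/r) ([norm_ellp_sum_unit_le]). A cotype alpha inequality would
    give m^(1/alpha) <= C m^(1/r) for every m, which is false when alpha < r
    ([cotype_const_pinfty]). *)

Set Implicit Arguments.
Unset Strict Implicit.
Unset Printing Implicit Defensive.

Import Order.TTheory GRing.Theory Num.Theory.
Import numFieldNormedType.Exports.

Local Open Scope ring_scope.
Local Open Scope ereal_scope.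

(** * Norms in l_p *)

Section SequenceNorms.
Context (R : realType).
Notation cnt := (counting : {measure set nat -> \bar R}).

(** For p = +oo the exponent is 0, so the bound is 1 even when m = 0. *)
Lemma Lnorm_counting_le_indic (p : \bar R) (hp : 1 <= p) (m : nat)
    (f : nat -> R) :
  (forall n, (`|f n| <= \1_(`I_m) n)%R) ->
  'N[cnt]_p[EFin \o f] <= (m%:R `^ fine p^-1)%:E.
Proof.
move=> fm; rewrite unlock; case: p hp => [p hp| |//].
  have p0 : (0 < p)%R by rewrite lee_fin in hp; lra.
  rewrite inver gt_eqF//= -poweR_EFin.
  apply: gt0_ler_poweR; rewrite ?invr_ge0 ?(ltW p0)//.
  - by rewrite in_itv/= leey andbT integral_ge0.
  - by rewrite in_itv/= leey andbT lee_fin.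
  - rewrite [leRHS](_ : _ = \int[cnt]_x (\1_(`I_m) x)%:E); last first.
      rewrite integral_indic// setIT /= /counting.
      rewrite asboolT; last exact: finite_II.
      congr (_%:R%:E); apply/esym/card_eq_fsetP.
      by rewrite fset_setK//; exact: finite_II.
    apply: ge0_le_integral => //= n _.
    rewrite lee_fin; have := fm n; rewrite indicE; case: (n \in _) => /= h.
      have := @ge0_ler_powR _ p (ltW p0) `|f n|%R 1%R.
      by rewrite powR1; apply => //; rewrite nnegrE.
    suff -> : `|f n|%R = 0%R by rewrite powR0// gt_eqF.
    by apply/eqP; rewrite eq_le h/=.
rewrite invey /= powRr0 => _; case: ifPn => // _.
apply/ess_supP/nearW => n /=; rewrite lee_fin (le_trans (fm n))//.
Qed.

Lemma le_norm_ellp (p : \bar R) (hp : 1 <= p) (x : ellp hp) (k : nat) :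
  (`|x k| <= `|x|)%R.
Proof.
rewrite -lee_fin [X in _ <= X](_ : _ = 'N[cnt]_p[EFin \o x]); last first.
  exact: finite_norm_fine.
have [mu0|] := pselect (0 < cnt setT); last first.
  case; rewrite (@lt_le_trans _ _ (cnt [set k]%classic))//; last first.
    by apply: le_measure; rewrite ?inE.
  by rewrite /= /counting asboolT// fset_set1 finmap.cardfs1.
move: p hp x => [p| |//] hp x; rewrite unlock.
  have p0 : (0 < p)%R by rewrite -lte_fin (lt_le_trans _ hp)// lte01.
  have -> : (`|x k|)%:E = (`|(EFin \o x) k| `^ p) `^ p^-1.
    by rewrite -poweRrM mulfV ?gt_eqF// poweRe1.
  apply: gt0_ler_poweR; rewrite ?invr_ge0 ?(ltW p0)//.
  - by rewrite in_itv/= leey lee_fin powR_ge0.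
  - by rewrite in_itv/= leey andbT integral_ge0.
  - rewrite ge0_integral_count//.
    apply: le_trans (nneseries_lim_ge k.+1 _) => [|n _ _]; last first.
      exact: poweR_ge0.
    by rewrite big_nat_recr//= leeDr// sume_ge0// => n _; exact: poweR_ge0.
    by move=> n; exact: poweR_ge0.
rewrite ifT//.
(* A singleton has counting measure 1, so a null set cannot contain k. *)
have [A [mA A0 h]] := ess_sup_ge cnt (abse \o (EFin \o x)).
apply: contrapT => xk.
have kA : ([set k] `<=` A)%classic by move=> _ ->; apply: h => /=.
have : cnt [set k]%classic <= cnt A by apply: le_measure; rewrite ?inE.
by rewrite A0 /= /counting asboolT// fset_set1 lee_fin finmap.cardfs1 ler10.
Qed.
End SequenceNorms.

Local Close Scope ereal_scope.

Section UnitVectors.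
Context (R : realType) (p : \bar R) (hp : (1 <= p)%E).
Notation cnt := (counting : {measure set nat -> \bar R}).

(** The k-th coordinate functional on l_p. *)
Definition ellp_coord (k : nat) (x : ellp hp) : R := x k.

Lemma ellp_coord_is_linear k : scalar (ellp_coord k).
Proof. by []. Qed.

HB.instance Definition _ k := GRing.isLinear.Build R (ellp hp) R _
  (ellp_coord k) (ellp_coord_is_linear k).

Lemma indic1_Lfun (k : nat) : (\1_[set k]%classic : nat -> R) \in Lfun cnt p.
Proof.
apply/andP; split; rewrite inE//=; rewrite /finite_norm.
apply: (@le_lt_trans _ _ (k.+1%:R `^ fine p^-1)%:E); last exact: ltry.
apply: Lnorm_counting_le_indic => // n.
rewrite !indicE normr_nat ler_nat; case: (boolP (n \in _)) => //.
rewrite inE => /= ->; suff -> : k \in `I_k.+1 by [].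
by rewrite inE/=.
Qed.

(** The k-th unit vector of l_p. *)
Definition ellp_unit (k : nat) : ellp hp := Lfun_Sub hp (indic1_Lfun k).

Lemma ellp_coord_unit k n : ellp_coord n (ellp_unit k) = (n == k)%:R.
Proof.
rewrite /ellp_coord /ellp_unit /= indicE; congr (_%:R : R); apply: congr1.
by apply/idP/eqP; rewrite inE.
Qed.

Lemma norm_ellp_sum_unit_le m (a : 'I_m -> R) : (forall i, `|a i| <= 1) ->
  `|\sum_(i < m) a i *: ellp_unit i| <= m%:R `^ fine p^-1%E.
Proof.
move=> a1; pose v : ellp hp := \sum_(i < m) a i *: ellp_unit i.
rewrite -/v -lee_fin [leLHS](_ : _ = 'N[cnt]_p[EFin \o v])%E; last first.
  exact: finite_norm_fine.
apply: Lnorm_counting_le_indic => // n.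
have -> : v n = \sum_(i < m) a i * (n == i)%:R.
  rewrite -/(ellp_coord n v) linear_sum; apply: eq_bigr => i _.
  by rewrite -ellp_coord_unit.
rewrite indicE; case: (ltnP n m) => nm.
  rewrite (bigD1 (Ordinal nm))//= eqxx mulr1 big1 ?addr0; last first.
    move=> i; rewrite -val_eqE/= eq_sym => /negbTE ->; exact: mulr0.
  by rewrite mem_set.
rewrite big1 ?normr0// => i _; rewrite gtn_eqF ?mulr0//.
exact: leq_trans nm.
Qed.

Lemma norm_ellp_unit0_le : `|ellp_unit 0| <= 1.
Proof.
have := @norm_ellp_sum_unit_le 1 (fun=> 1).
by rewrite big_ord1 scale1r powR1 => -> // i; rewrite normr1.
Qed.
End UnitVectors.

(** * Elementary tensors *)

Section PureTensors.
Context (R : realType) (E F G : normedModType R).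
Implicit Types (x : E) (y : F) (z : G).

Lemma elem_tensor_is_tensor x y z : elem_tensor x y z \in @is_tensor R E F G.
Proof. by rewrite inE; exists [:: (x, y, z)]; rewrite /sum_tensor big_seq1. Qed.

(** The elementary tensor x (x) y (x) z, as an element of the completed
    projective tensor product. *)
Definition pure_tensor x y z : proj_tensor E F G :=
  completion_embed _ (Tensor (elem_tensor_is_tensor x y z)).

Lemma pure_tensor_is_linear x y : linear (pure_tensor x y).
Proof.
move=> a z w; rewrite /pure_tensor -linearP; congr (completion_embed _ _).
apply: val_inj => /=; apply: funext => -[b [b1 b2 b3]].
exact: (b3 x y a z w).
Qed.

HB.instance Definition _ x y := GRing.isLinear.Build R G (proj_tensor E F G) _
  (pure_tensor x y) (pure_tensor_is_linear x y).

Lemma norm_pure_tensor_le x y z : `|pure_tensor x y z| <= `|x| * `|y| * `|z|.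
Proof.
rewrite norm_completion_embed /=.
rewrite (le_trans (@proj_norm_le _ _ _ _ _ [:: (x, y, z)] _))//.
  by rewrite /sum_tensor big_seq1.
by rewrite /rep_cost big_seq1.
Qed.

(** A trilinear form b of norm at most 1 is evaluated termwise on every
    representation of x (x) y (x) z as a finite sum of elementary tensors, so
    |b x y z| is at most the cost of any representation. *)
Lemma trilinear_le_norm_pure_tensor (b : E -> F -> G -> R) x y z :
  trilinear b -> (forall u v w, `|b u v w| <= `|u| * `|v| * `|w|) ->
  `|b x y z| <= `|pure_tensor x y z|.
Proof.
move=> hb b1; rewrite norm_completion_embed /=.
apply: lb_le_inf.
  by have [] := proj_norm_costs (Tensor (elem_tensor_is_tensor x y z)).
move=> _ [s /= es <-].
have -> : b x y z = \sum_(t <- s) b t.1.1 t.1.2 t.2.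
  have := congr1 (@^~ (exist _ b hb)) es.
  by rewrite /elem_tensor/= /sum_tensor fct_sumE.
by rewrite (le_trans (ler_norm_sum _ _ _))// ler_sum.
Qed.
End PureTensors.

(** * A criterion for an infinite cotype constant *)

Section CotypeFailure.
Context (R : realType) (X : normedModType R).

Lemma rademacher_mean_le m (x : 'I_m -> X) (c : R) :
  (forall eps : {ffun 'I_m -> bool},
    `|\sum_(i < m) (-1) ^+ eps i *: x i| <= c) ->
  rademacher_mean x <= c.
Proof.
move=> h; rewrite /rademacher_mean mulrC ler_pdivrMr ?exprn_gt0//.
rewrite (le_trans (ler_sum _ (fun e _ => h e)))// sumr_const.
by rewrite card_ffun card_bool card_ord -[c *+ _]mulr_natr natrX.
Qed.

(** With C a cotype constant, m vectors as in the hypothesis give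
    m^(1/alpha) <= C m^s, which fails once m^(1/alpha - s) > C. *)
Lemma cotype_const_pinfty (alpha s : R) : 0 < alpha -> s < alpha^-1 ->
  (forall m : nat, exists x : 'I_m -> X, (forall i, 1 <= `|x i|) /\
    forall eps : {ffun 'I_m -> bool},
      `|\sum_(i < m) (-1) ^+ eps i *: x i| <= m%:R `^ s) ->
  cotype_const X alpha = +oo%E.
Proof.
move=> a0 sa hx; rewrite /cotype_const.
rewrite (_ : [set _ | _ in _]%classic = set0) ?ereal_inf0//.
apply/seteqP; split => // _ [C [/= C0 hC] _].
have d0 : 0 < alpha^-1 - s by rewrite subr_gt0.
have [m mC] : exists m : nat, C `^ (alpha^-1 - s)^-1 < m%:R.
  by exists (Num.truncn (C `^ (alpha^-1 - s)^-1)).+1; rewrite truncnS_gt.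
have m0 : 0 < m%:R :> R by rewrite (le_lt_trans _ mC)// powR_ge0.
have [x [x1 xs]] := hx m.
have := hC m x; apply/negP; rewrite -ltNge.
apply: (@le_lt_trans _ _ (C * m%:R `^ s)).
  by rewrite ler_wpM2l ?(ltW C0)// rademacher_mean_le.
apply: (@lt_le_trans _ _ (m%:R `^ alpha^-1)).
  rewrite -(subrK s alpha^-1) powRD ?(gt_eqF m0) ?implybT//.
  rewrite ltr_pM2r ?powR_gt0//.
  have -> : C = C `^ (alpha^-1 - s)^-1 `^ (alpha^-1 - s).
    by rewrite -powRrM mulVf ?gt_eqF// powRr1// ltW.
  by rewrite gt0_ltr_powR// nnegrE ?powR_ge0// ltW.
apply: ge0_ler_powR; rewrite ?nnegrE ?ler0n ?invr_ge0 ?(ltW a0)//.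
  by apply: sumr_ge0 => i _; exact: powR_ge0.
have -> : m%:R = \sum_(i < m) (1 : R) by rewrite sumr_const card_ord.
apply: ler_sum => i _.
have := @ge0_ler_powR R alpha (ltW a0) 1 `|x i|.
by rewrite powR1; apply => //; rewrite nnegrE.
Qed.
End CotypeFailure.

(** * Failure of cotype in the projective tensor product *)

(** z |-> e_0 (x) e_0 (x) z embeds l_r isometrically, and l_r has no cotype
    alpha < r. *)
Lemma cotype_const_proj_tensor_ellp (R : realType) (p q r : \bar R)
    (hp : (1 <= p)%E) (hq : (1 <= q)%E) (hr : (1 <= r)%E) (alpha : R) :
  0 < alpha -> (alpha%:E < r)%E ->
  cotype_const (proj_tensor (ellp hp) (ellp hq) (ellp hr)) alpha = +oo%E.
Proof.
move=> a0 ar; apply: (@cotype_const_pinfty _ _ _ (fine r^-1%E)) => //.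
  move: r hr ar => [r| |//] hr ar; last by rewrite invey invr_gt0.
  have r0 : 0 < r by move: ar; rewrite lte_fin; exact: lt_trans.
  by rewrite inver gt_eqF//= ltf_pV2.
move=> m; exists (fun i =>
  pure_tensor (ellp_unit hp 0) (ellp_unit hq 0) (ellp_unit hr i)).
split => [i|eps].
  pose b (x : ellp hp) (y : ellp hq) (z : ellp hr) :=
    ellp_coord 0 x * ellp_coord 0 y * ellp_coord i z.
  have <- : `|b (ellp_unit hp 0) (ellp_unit hq 0) (ellp_unit hr i)| = 1.
    by rewrite /b !ellp_coord_unit !eqxx !mulr1 normr1.
  apply: trilinear_le_norm_pure_tensor => [|x y z].
    by split=> [y z|x z|x y] a u v; rewrite /b linearP/=; lra.
  by rewrite /b !normrM !ler_pM// ?mulr_ge0// le_norm_ellp.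
under eq_bigr do rewrite -linearZ/=.
rewrite -linear_sum/= (le_trans (norm_pure_tensor_le _ _ _))//.
rewrite (@le_trans _ _ (1 * `|\sum_(i < m) (-1) ^+ eps i *: ellp_unit hr i|))//.
  by rewrite ler_wpM2r// mulr_ile1// norm_ellp_unit0_le.
rewrite mul1r; apply: norm_ellp_sum_unit_le => i.
by rewrite normrX normrN1 expr1n.
Qed.

Local Open Scope ereal_scope.

(** * Arithmetic of the exponents *)

Lemma gt4_of_inve_sum_lt_half (R : realType) (q r : \bar R) :
  1 <= q -> q <= r ->
  q^-1 + r^-1 < (2^-1)%:E -> 4%:E < r.
Proof.
move: q r => [q| |//] [r| |//]; rewrite ?leey ?ltry//.
rewrite !lee_fin => q1 qr.
have q0 : (0 < q)%R by lra.
have r0 : (0 < r)%R by lra.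
rewrite !inver !gt_eqF// !lte_fin.
have : (r^-1 <= q^-1)%R by rewrite lef_pV2 ?posrE.
move=> h1 h2; have h : (r^-1 < 4^-1)%R by lra.
by rewrite ltf_pV2 ?posrE in h.
Qed.

Lemma lt3_of_lt_div3 (R : realType) (alpha : R) (d : \bar R) : 1 <= d ->
  alpha%:E < 3%:E / d -> (alpha < 3)%R.
Proof.
case: d => [d| |//]; last by rewrite invey mule0 !lte_fin => _; lra.
rewrite lee_fin => d1; rewrite inver gt_eqF ?(lt_le_trans ltr01)//.
rewrite -EFinM !lte_fin.
rewrite ltr_pdivlMr; last lra.
nra.
Qed.

Unset Implicit Arguments.

Theorem corollary7p1 (R : realType) (p q r : \bar R)
    (hp : 1 <= p) (hq : 1 <= q) (hr : 1 <= r) (hpq : p <= q) (hqr : q <= r)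
    (alpha : R) (halpha : (0 < alpha)%R) :
  let X := proj_tensor (ellp hp) (ellp hq) (ellp hr) in
  [/\ p <= 2%:E -> q^-1 + r^-1 < (2^-1)%:E -> 1 <= p^-1 + q^-1 + r^-1 ->
        alpha%:E < 3%:E / (1 + q^-1 + r^-1) ->
        cotype_const X alpha = +oo,
      p < 2%:E -> p^-1 + q^-1 + r^-1 <= 1 ->
        alpha%:E < 3%:E / (2%:E - p^-1) ->
        cotype_const X alpha = +oo &
      p^-1 + q^-1 + r^-1 < (2^-1)%:E ->
        alpha%:E < 3%:E / (1 + p^-1 + q^-1 + r^-1) ->
        cotype_const X alpha = +oo].
Proof.
have pos (t : \bar R) : 1 <= t -> 0 <= t^-1.
  by move=> t1; rewrite inve_ge0 (le_trans _ t1)// lee01.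
have [[p0 q0] r0] := (pos _ hp, pos _ hq, pos _ hr).
have main d : 1 <= d -> alpha%:E < 3%:E / d -> q^-1 + r^-1 < (2^-1)%:E ->
    cotype_const (proj_tensor (ellp hp) (ellp hq) (ellp hr)) alpha = +oo.
  move=> d1 ad qr; apply: cotype_const_proj_tensor_ellp => //.
  apply: lt_trans (gt4_of_inve_sum_lt_half hq hqr qr); rewrite lte_fin.
  by have := lt3_of_lt_div3 d1 ad; lra.
move=> X; split.
- move=> _ qr _ /main; apply => //.
  by rewrite -addeA leeDl// adde_ge0.
- move=> p2 pqr /main; apply.
    case: p hp p2 {hpq X main p0 pqr} => [p||//] hp p2; last by rewrite invey.
    move: hp p2; rewrite lee_fin lte_fin => p1 p2.
    have pV : (p^-1 <= 1)%R by rewrite invf_le1//; lra.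
    by rewrite inver gt_eqF -?EFinB ?lee_fin; lra.
  case: p hp p2 pqr {hpq X main p0} => [p||//] // p1 p2.
  move: p1 p2; rewrite lee_fin lte_fin => p1 p2.
  have pV : (2^-1 < p^-1)%R by rewrite ltf_pV2 ?posrE; lra.
  rewrite inver gt_eqF; last lra.
  rewrite -addeA; case: (q^-1 + r^-1) => [s| |] //; last by rewrite ltNyr.
  by rewrite -EFinD lee_fin lte_fin => h; lra.
- move=> pqr /main; apply.
    by rewrite -!addeA leeDl// !adde_ge0.
  by apply: le_lt_trans pqr; rewrite -addeA leeDr.
Qed.
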